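(* Let $z(t)=z^\ast+\sum_{j\ge1}a_jt^{p_j}$ be a Puiseux series as in the context, let $m\ge1$, set $p_0=0$, and let $w=(w_0,\ldots,w_m)^\top\in\mathbb R^{m+1}$ be a vector satisfying $$\sum_{i=0}^m w_i\,t_i^{p_j}=0\quad (j=0,1,\ldots,m-1),\qquad \sum_{i=0}^m w_i\,t_i^{p_m}=1 .$$ Suppose that $t_1,\ldots,t_m$ are functions of $t_0$ and $0<t_m<\ldots<t_0$. Define $$A_m:=\sum_{i=0}^m w_i\,z(t_i),\qquad B_m:=\sum_{i=0}^m w_i\,t_i\,\dot z(t_i),\qquad \hat p_m=\frac{\|B_m\|}{\|A_m\|}.$$ Then $\hat p_m=p_m+O(t_0^{p_{m+1}-p_m})$ as $t_0\to0$. Furthermore, $a_m=A_m+O(t_0^{p_{m+1}-p_m})$. If $a_mt^{p_m}$ is the last term in the Puiseux series of $z(\cdot)$, then the estimates are exact: $\hat p_m=p_m$ and $A_m=a_m$.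
   Context: $z(t)=z^\ast+a_1t^{p_1}+a_2t^{p_2}+\ldots=z^\ast+\sum_{j=1}^\infty a_jt^{p_j}$ is a (possibly terminating) Puiseux series, where $z^\ast\in\mathbb C^n$, $a_j\in\mathbb C^n\setminus\{0\}$ for each $j\ge1$, and $0<p_1<p_2<\ldots$ are strictly increasing rational numbers. It is assumed that there exists an integer $d$ such that $dp_i\in\mathbb N$ for all $i$, and the power series $z^\ast+\sum_{j=1}^\infty a_js^{p_jd}$ obtained by the change $t^{1/d}\mapsto s$ is convergent in some neighborhood of $s=0$. $\dot z(t)$ denotes the derivative of $z(t)$ with respect to $t$, and $t_0$ is small enough that all quantities are defined. *)

(* Defs.v *)
From HB Require Import structures.
From mathcomp Require Export all_boot all_order all_algebra.
From mathcomp Require Export complex.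
From mathcomp Require Export all_classical all_reals all_analysis.
Export Order.TTheory GRing.Theory Num.Theory.
Export numFieldNormedType.Exports.

Set Implicit Arguments.
Unset Strict Implicit.
Unset Printing Implicit Defensive.

Local Open Scope classical_set_scope.
Local Open Scope ring_scope.
Local Open Scope complex_scope.

(* numFieldNormedType.Exports covers only the carriers of abstract numeric
   fields, so R[i] needs its own instances. *)
#[export, non_forgetful_inheritance]
HB.instance Definition _ (R : realType) := NormedModule.copy R[i] R[i]^o.

(* [last] is [Some l] when the series terminates with the term of index l, and
   [None] when there are infinitely many terms. *)
Definition is_term (last : option nat) (j : nat) : bool :=
  if last is Some l then (j <= l)%N else true.

(* z^* + \sum_(j >= 1) a_j t^(p_j).  The values of [coef] at 0 and of [coef]
   and [expo] at indices past the last term are irrelevant.  In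
   [puiseux_conv], [e j] is the natural number d * p_j, the exponent of a_j in
   the complex power series obtained by substituting s for t^(1/d). *)
Record puiseux (R : realType) (n : nat) := Puiseux {
  zstar : 'cV[R[i]]_n;
  coef : nat -> 'cV[R[i]]_n;
  expo : nat -> rat;
  last_term : option nat;
  expo0 : expo 0 = 0;
  expo_lt : forall j, is_term last_term j.+1 -> expo j < expo j.+1;
  coef_neq0 : forall j, (0 < j)%N -> is_term last_term j -> coef j != 0;
  puiseux_conv : exists (d : nat) (e : nat -> nat),
    [/\ (0 < d)%N,
        forall j, is_term last_term j -> (e j)%:R = d%:R * expo j &
        \forall s \near (0 : R[i]),
          cvgn (fun k : nat => zstar +
            \sum_(1 <= j < k | is_term last_term j) s ^+ e j *: coef j)]
}.

(* Meaningful for small t > 0, where t^(p_j) is the positive real power. *)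
Definition puiseux_eval (R : realType) (n : nat) (z : puiseux R n) (t : R)
    : 'cV[R[i]]_n :=
  limn (fun k : nat => zstar z +
    \sum_(1 <= j < k | is_term (last_term z) j)
      (t `^ ratr (expo z j))%:C *: coef z j).

(* The derivative of a C^n-valued function of a real variable; [derive] does
   not apply since 'cV[R[i]]_n is a normed module over R[i] but not over R. *)
Definition derivC (R : realType) (n : nat) (f : R -> 'cV[R[i]]_n) (t : R)
    : 'cV[R[i]]_n :=
  lim ((h^-1)%:C *: (f (t + h) - f t) @[h --> (0 : R)^']).

(* Real-valued norms on C^n; the library norm on 'cV[R[i]]_n is the max norm,
   with values in R[i]. *)
Definition is_norm (R : realType) (n : nat) (N : 'cV[R[i]]_n -> R) : Prop :=
  [/\ forall x y, N (x + y) <= N x + N y,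
      forall (c : R[i]) x, N (c *: x) = complex.Re `|c| * N x &
      forall x, N x = 0 -> x = 0].

Section Extrapolation.
Context (R : realType) (n m : nat) (z : puiseux R n).
(* The sampling points t_0, ..., t_m and the weights w_0, ..., w_m. *)
Context (t : 'I_m.+1 -> R) (w : 'cV[R]_m.+1).

Definition is_weight : Prop :=
  (forall j, (j < m)%N ->
     \sum_(i < m.+1) w i ord0 * t i `^ ratr (expo z j) = 0) /\
  \sum_(i < m.+1) w i ord0 * t i `^ ratr (expo z m) = 1.

Definition Am : 'cV[R[i]]_n :=
  \sum_(i < m.+1) (w i ord0)%:C *: puiseux_eval z (t i).

Definition Bm : 'cV[R[i]]_n :=
  \sum_(i < m.+1) (w i ord0 * t i)%:C *: derivC (puiseux_eval z) (t i).

Definition phat (N : 'cV[R[i]]_n -> R) : R := N Bm / N Am.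

End Extrapolation.

(* Main.v *)
Require Import Defs.
From mathcomp Require Import ring lra zify.

Set Implicit Arguments.
Unset Strict Implicit.
Unset Printing Implicit Defensive.

Local Open Scope classical_set_scope.
Local Open Scope ring_scope.
Local Open Scope complex_scope.

(** Let L f be the sum of the w_i f(t_i). It kills t^(p_j) for j < m and maps
    t^(p_m) to 1, so A_m = L z is a_m plus the sum of the a_j L(t^(p_j)) over
    j > m. As t z'(t) is the Puiseux series with coefficients p_j a_j, in the same
    way B_m is p_m a_m plus the sum of the p_j a_j L(t^(p_j)) over j > m. When
    a_m t^(p_m) is the last term, both remainders are empty.

    The weights need not be bounded, since nodes may be arbitrarily close to each
    other. But L is a generalized divided difference, and repeated use of
    Rolle's theorem gives (divided_difference_power)
      L(t^q) = xi^(q - p_m) * prod_(l < m) (q - p_l) / (p_m - p_l)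
    for some xi between t_m and t_0. Thus |L(t^(p_j))| is at most a polynomial in
    p_j times t_0^(p_j - p_m), whatever the nodes are. With s = t^(1/d) the
    exponents become natural numbers, the polynomial factor is absorbed by a
    smaller radius of convergence, and both remainders are
    O(t_0^(p_(m+1) - p_m)) (extrapolation_error, extrapolation_errors).

    Convergence, the derivative of z and the estimates are obtained for the real
    and imaginary parts of the entries (rcoord_puiseux_eval, rcoord_derivC). Since
    |N B_m - p_m N A_m| <= N (B_m - p_m A_m) and N A_m stays away from 0, the
    quotient N B_m / N A_m differs from p_m by a quantity of the same order. *)

(** * Divided differences for real powers *)

Lemma stepwise_decr_bounds {R : realType} (x : nat -> R) m :
  (forall i, (i < m)%N -> x i.+1 < x i) ->
  forall i, (i <= m)%N -> x m <= x i <= x 0%N.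
Proof.
move=> decr i im; apply/andP; split.
  rewrite -(subKn im); elim: (_ - i)%N (leq_subr i m) => {i im} [|k IHk] km.
    by rewrite subn0.
  by apply: le_trans (IHk (ltnW km)) _; rewrite -(subnSK km) ltW// decr//; lia.
elim: i im => // i IH im; apply: le_trans (IH (ltnW im)).
exact/ltW/decr.
Qed.

Section GeneralizedVandermonde.
Context {R : realType}.
Implicit Types (c p x : nat -> R).

Lemma powRD_gt0 (u a b : R) : 0 < u -> u `^ (a + b) = u `^ a * u `^ b.
Proof. by move=> u0; apply: powRD; rewrite (gt_eqF u0) implybT. Qed.

Lemma derive_power_sum n c p (u : R) : 0 < u ->
  is_derive u 1 (fun u => \sum_(j < n) c j * u `^ p j)
    (\sum_(j < n) c j * (p j * u `^ (p j - 1))).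
Proof.
move=> u0.
have -> : (fun u : R => \sum_(j < n) c j * u `^ p j) =
    \sum_(j < n) (c j \*: (fun u : R => u `^ p j)).
  by apply/funext => v; rewrite fct_sumE.
apply: is_derive_sum => j.
have := is_derive1_powR (p j) u0 => dp.
exact: (@is_deriveZ _ _ _ (fun u : R => u `^ p j) (c j)).
Qed.

(** Rolle's theorem for u^(-a) f(u): the factor u^(-a) keeps the zeros, and up
    to the factor u^(-a-1) its derivative is u f'(u) - a f(u), which multiplies
    each coefficient by p j - a and so removes the exponent a from the sum. *)
Lemma power_sum_rolle n c p (a x y : R) : 0 < x -> x < y ->
  \sum_(j < n) c j * x `^ p j = 0 -> \sum_(j < n) c j * y `^ p j = 0 ->
  exists2 xi, x < xi < y & \sum_(j < n) c j * (p j - a) * xi `^ p j = 0.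
Proof.
move=> x0 xy fx fy.
pose f (u : R) := \sum_(j < n) c j * u `^ (p j - a).
have fE u : 0 < u -> f u = u `^ (- a) * \sum_(j < n) c j * u `^ p j.
  move=> u0; rewrite /f mulr_sumr; apply: eq_bigr => j _.
  by rewrite powRD_gt0//; ring.
have df (u : R) : 0 < u -> is_derive u 1 f
    (\sum_(j < n) c j * ((p j - a) * u `^ (p j - a - 1))).
  exact: (@derive_power_sum n c (fun j => p j - a)).
have [|||xi] := @Rolle R f x y xy.
- by move=> u; rewrite in_itv/= => /andP[xu _]; have [] := df u (lt_trans x0 xu).
- apply/derivable_within_continuous => u; rewrite in_itv/= => /andP[xu _].
  by have [] := df u (lt_le_trans x0 xu).
- by rewrite !fE ?fx ?fy ?mulr0// (lt_trans x0 xy).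
rewrite in_itv/= => /andP[xxi xiy] dxi; exists xi; first by rewrite xxi.
have xi0 := lt_trans x0 xxi.
have /eqP := @derive_val _ _ _ _ _ _ _ dxi.
rewrite (@derive_val _ _ _ _ _ _ _ (df xi xi0)) => /eqP d0.
rewrite -[RHS](mulr0 (xi `^ (a + 1))) -[X in _ = _ * X]d0 mulr_sumr.
apply: eq_bigr => j _.
have -> : xi `^ p j = xi `^ (a + 1) * xi `^ (p j - a - 1).
  by rewrite -powRD_gt0//; congr (_ `^ _); ring.
by ring.
Qed.

Lemma power_sum_rolle_seq n c p (s : seq R) x :
  0 < x (size s) -> (forall i, (i < size s)%N -> x i.+1 < x i) ->
  (forall i, (i <= size s)%N -> \sum_(j < n) c j * x i `^ p j = 0) ->
  exists2 xi, x (size s) <= xi <= x 0%N &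
    \sum_(j < n) c j * (\prod_(a <- s) (p j - a)) * xi `^ p j = 0.
Proof.
elim: s c x => [|a s IH] c x /= x0 decr fx.
  exists (x 0%N); first by rewrite lexx.
  by rewrite -[RHS](fx 0%N)//; apply: eq_bigr => j _; rewrite big_nil mulr1.
have xpos i : (i <= (size s).+1)%N -> 0 < x i.
  by move=> /(stepwise_decr_bounds decr)/andP[xi _]; exact: lt_le_trans xi.
have /choice[y yP] : forall i, exists xi, (i < (size s).+1)%N ->
    x i.+1 < xi < x i /\
    \sum_(j < n) c j * (p j - a) * xi `^ p j = 0.
  move=> i; case: (ltnP i (size s).+1) => [ik|]; last by exists 0.
  have [//|||xi] := @power_sum_rolle n c p a (x i.+1) (x i) (xpos _ ik).
  - exact: decr.
  - exact: fx.
  - by apply: fx; exact: ltnW.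
  by exists xi.
have [|i ik|i ik|xi xiE xi0] := IH (fun j => c j * (p j - a)) y.
- have [/andP[+ _] _] := yP (size s) (ltnSn _).
  by apply: lt_trans; exact: xpos.
- have [/andP[yi _] _] := yP i (ltnW ik).
  have [/andP[_ yi1] _] := yP i.+1 ik.
  exact: lt_trans yi1 yi.
- by have [] := yP i ik.
exists xi; last first.
  by rewrite -[RHS]xi0; apply: eq_bigr => j _; rewrite big_cons !mulrA.
have [/andP[ys _] _] := yP (size s) (ltnSn _).
have [/andP[_ y0] _] := yP 0%N (ltn0Sn _).
by case/andP: xiE => h1 h2; rewrite (le_trans (ltW ys) h1) (le_trans h2 (ltW y0)).
Qed.

(** Invertibility of the generalized Vandermonde matrix: eliminating every
    exponent but p J leaves one power, which has no positive zero. *)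
Lemma power_sum_eq0 m c p x :
  0 < x m -> (forall i, (i < m)%N -> x i.+1 < x i) ->
  {in [pred j | (j <= m)%N] &, injective p} ->
  (forall i, (i <= m)%N -> \sum_(j < m.+1) c j * x i `^ p j = 0) ->
  forall j, (j <= m)%N -> c j = 0.
Proof.
move=> x0 decr pinj fx J Jm.
(* bump J runs through all indices except J. *)
pose s := [seq p (bump J l) | l <- iota 0 m].
have sz : size s = m by rewrite size_map size_iota.
have [|||xi xiE] := @power_sum_rolle_seq m.+1 c p s x; rewrite ?sz//.
rewrite (bigD1 (Ordinal (Jm : J < m.+1)%N))//= [X in _ + X]big1 => [|j jJ]; last first.
  have [l lm jE] : exists2 l, (l < m)%N & j = bump J l :> nat.
    case: (unliftP (Ordinal (Jm : J < m.+1)%N) j) jJ => [l ->|->]; last by rewrite eqxx.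
    by move=> _; exists l.
  rewrite (_ : \prod_(_ <- _) _ = 0) ?mulr0 ?mul0r//.
  apply/eqP; rewrite prodf_seq_eq0; apply/hasP; exists (p j); last by rewrite subrr eqxx.
  by rewrite jE; apply/mapP; exists l => //; rewrite mem_iota leq0n add0n.
rewrite sz in xiE; have xi0 : 0 < xi by case/andP: xiE => xi1 _; exact: lt_le_trans xi1.
rewrite addr0 => /eqP; rewrite !mulf_eq0 (gt_eqF (powR_gt0 _ xi0)) orbF.
case/orP => [/eqP//|]; rewrite prodf_seq_eq0 => /hasP[_ /mapP[l lm ->]]/=.
rewrite subr_eq0 => /eqP/pinj; rewrite !inE => /(_ Jm) E.
have : J = bump J l.
  by apply: E; move: lm; rewrite mem_iota /bump/=; lia.
by move/eqP; rewrite (negbTE (neq_bump _ _)).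
Qed.

(** Mean value theorem for generalized divided differences. The functional with
    nodes x and weights w sends the combination of the powers p 0, ..., p m that
    interpolates u^q at the nodes to its last coefficient, hence sends u^q to
    that coefficient too. The interpolation error has m + 1 zeros, and
    eliminating the exponents p 0, ..., p (m - 1) from it leaves an equation
    between the powers p m and q that determines the coefficient. *)
Lemma divided_difference_power m (w : 'I_m.+1 -> R) p x (q : R) :
  0 < x m -> (forall i, (i < m)%N -> x i.+1 < x i) ->
  {in [pred j | (j <= m)%N] &, injective p} ->
  (forall j, (j < m)%N -> \sum_(i < m.+1) w i * x i `^ p j = 0) ->
  \sum_(i < m.+1) w i * x i `^ p m = 1 ->
  exists2 xi, x m <= xi <= x 0%N &
    \sum_(i < m.+1) w i * x i `^ q =
      \prod_(l < m) ((q - p l) / (p m - p l)) * xi `^ (q - p m).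
Proof.
move=> x0 decr pinj wp wm.
pose V : 'M[R]_m.+1 := \matrix_(j, i) (x i `^ p j).
pose b : 'rV[R]_m.+1 := \row_i (x i `^ q).
have Vu : V \in unitmx.
  rewrite -row_free_unit; apply: inj_row_free => v vV.
  apply/rowP => j; rewrite mxE.
  have := @power_sum_eq0 m (fun j => v ord0 (inord j)) p x x0 decr pinj _ j (ltn_ord j).
  rewrite inord_val; apply => i im.
  have /rowP/(_ (inord i)) := vV; rewrite !mxE => {2}<-.
  by apply: eq_bigr => k _; rewrite !mxE inord_val inordK.
pose cv := b *m invmx V.
pose c j := cv ord0 (inord j).
have cE i : (i <= m)%N -> \sum_(j < m.+1) c j * x i `^ p j = x i `^ q.
  move=> im; have /rowP/(_ (inord i)) : cv *m V = b by rewrite mulmxKV.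
  rewrite mxE [b _ _]mxE inordK// => <-.
  by apply: eq_bigr => k _; rewrite [V _ _]mxE /c inord_val inordK.
have -> : \sum_(i < m.+1) w i * x i `^ q = c m.
  under eq_bigr => i _ do rewrite -cE ?leq_ord// mulr_sumr.
  rewrite exchange_big big_ord_recr/= big1 ?add0r => [|j _].
    by under eq_bigr => i _ do rewrite mulrCA; rewrite -mulr_sumr wm mulr1.
  by under eq_bigr => i _ do rewrite mulrCA; rewrite -mulr_sumr wp ?mulr0.
pose s := [seq p l | l <- iota 0 m].
have sz : size s = m by rewrite size_map size_iota.
(* The interpolation error, as a sum of m + 2 powers. *)
pose c' j := if (j <= m)%N then - c j else 1.
pose p' j := if (j <= m)%N then p j else q.
have [|||xi xiE] := @power_sum_rolle_seq m.+2 c' p' s x; rewrite ?sz//.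
  move=> i im; rewrite big_ord_recr/= /c' /p' ltnn mul1r -cE//.
  rewrite -big_split big1//= => j _.
  by rewrite leq_ord mulNr addNr.
rewrite sz in xiE.
have xi0 : 0 < xi by case/andP: xiE => xi1 _; exact: lt_le_trans xi1.
rewrite big_ord_recr big_ord_recr/= [X in X + _ + _]big1 => [|j _]; last first.
  rewrite (_ : \prod_(_ <- _) _ = 0) ?mulr0 ?mul0r//.
  apply/eqP; rewrite prodf_seq_eq0; apply/hasP; exists (p j) => /=.
    by apply/mapP; exists (val j); rewrite // mem_iota/=.
  by rewrite /p' (ltnW (ltn_ord j)) subrr eqxx.
have iotaE : iota 0 m = index_iota 0 m by rewrite /index_iota subn0.
rewrite add0r /c' /p' leqnn ltnn mul1r !big_map iotaE !big_mkord => H; exists xi => //.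
have nz : \prod_(l < m) (p m - p l) != 0.
  apply/prodf_neq0 => l _; rewrite subr_eq0; apply/eqP => /pinj.
  rewrite !inE leqnn (ltnW (ltn_ord l)) => /(_ isT isT) E.
  by have := ltn_ord l; rewrite -E ltnn.
rewrite big_split/= prodfV.
have E : xi `^ q = xi `^ p m * xi `^ (q - p m).
  by rewrite -powRD_gt0//; congr (_ `^ _); ring.
apply: (mulIf nz); apply: (mulIf (lt0r_neq0 (powR_gt0 (p m) xi0))).
move/eqP: H; rewrite mulNr mulNr addrC subr_eq0 E => /eqP <-.
by field.
Qed.

End GeneralizedVandermonde.

(** * Power series with sparse exponents *)

Section LacunarySeries.
Context {R : realType}.

Definition lacunary (b : nat -> R) (e : nat -> nat) (s : R) : R :=
  limn (series (fun j => b j * s ^+ e j)).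

Lemma geometric_bounded_series (u : nat -> R) (K : R) :
  (forall j, `|u j| <= K * 2^-1 ^+ j) ->
  cvgn (series u) /\ `|limn (series u)| <= 2 * K.
Proof.
move=> uK.
have half : `|2^-1 : R| < 1 by rewrite ger0_norm// invf_lt1// ltr1n.
have cg := @cvg_geometric_series R K _ half.
have cn : cvgn [normed series u].
  apply: (@series_le_cvg _ _ (geometric K 2^-1)) => //.
  - by move=> n; exact: normr_ge0.
  - by move=> n; exact: le_trans (normr_ge0 _) (uK n).
  - exact: is_cvg_geometric_series.
split; first exact: normed_cvg.
apply: (le_trans (lim_series_norm cn)).
have -> : 2 * K = limn (series (geometric K 2^-1)).
  by rewrite (cvg_lim _ cg)//; field.
by apply: lim_series_le => //; exact: is_cvg_geometric_series.
Qed.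

(** Taylor estimate, multiplied by rho^2 to have no negative or truncated
    exponent of rho on the right. *)
Lemma pow_remainder_le (e : nat) (x h rho : R) :
  `|x| <= rho -> `|x + h| <= rho ->
  `|(x + h) ^+ e - x ^+ e - h * (e%:R * x ^+ e.-1)| * rho ^+ 2 <=
    h ^+ 2 * (e%:R ^+ 2 * rho ^+ e).
Proof.
move=> xr xhr; have r0 : 0 <= rho := le_trans (normr_ge0 _) xr.
elim: e => [|e IH].
  by rewrite !expr0 subrr mul0r mulr0 subr0 normr0 mul0r expr0n/= mul0r mulr0.
set D := (X in `|X| * _) in IH.
have -> : (x + h) ^+ e.+1 - x ^+ e.+1 - h * (e.+1%:R * x ^+ e.+1.-1) =
    (x + h) * D + h ^+ 2 * (e%:R * x ^+ e.-1).
  rewrite /D; case: (e) => [|k] /=; rewrite ?expr0 ?expr1; last rewrite !exprS -!natr1; ring.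
apply: le_trans (ler_wpM2r (sqr_ge0 _) (ler_normD _ _)) _.
rewrite mulrDl.
have h1 : `|(x + h) * D| * rho ^+ 2 <= h ^+ 2 * (e%:R ^+ 2 * rho ^+ e.+1).
  rewrite normrM -mulrA; apply: le_trans (ler_wpM2r _ xhr) _.
    by rewrite mulr_ge0// sqr_ge0.
  rewrite [leRHS](_ : _ = rho * (h ^+ 2 * (e%:R ^+ 2 * rho ^+ e))) ?ler_wpM2l//.
  by rewrite (exprS rho); ring.
have h2 : `|h ^+ 2 * (e%:R * x ^+ e.-1)| * rho ^+ 2 <=
    h ^+ 2 * (e%:R * rho ^+ e.+1).
  rewrite normrM (ger0_norm (sqr_ge0 h)) -mulrA ler_wpM2l ?sqr_ge0//.
  rewrite normrM normr_nat -mulrA; case: (e) => [|k] /=; first by rewrite !mul0r.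
  rewrite ler_wpM2l// -(addn2 k) exprD ler_wpM2r ?sqr_ge0// normrX.
  by rewrite lerXn2r ?nnegrE.
apply: le_trans (lerD h1 h2) _.
rewrite -mulrDr ler_wpM2l ?sqr_ge0// -mulrDl ler_wpM2r ?exprn_ge0//.
rewrite -natrX -natrX -natrD ler_nat; lia.
Qed.

Section Series.
Variables (b : nat -> R) (e : nat -> nat) (r M : R).
Hypothesis r_gt0 : 0 < r.
Hypothesis e_ge : forall j, (j <= e j)%N.
Hypothesis bM : forall j, `|b j| * r ^+ e j <= M.

(** Polynomial factors in the exponent are absorbed by a smaller radius, as
    e^k <= (2^e)^k = (2^k)^e. *)
Lemma weighted_term_le k s j : 0 <= s -> s <= r / 2 ^+ k.+1 ->
  `|b j| * (e j)%:R ^+ k * s ^+ e j <= M * 2^-1 ^+ j.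
Proof.
move=> s0 sr.
have h2 : (0 : R) < 2 ^+ k by rewrite exprn_gt0.
have ek : (e j)%:R ^+ k <= (2 ^+ k) ^+ e j :> R.
  by rewrite exprAC lerXn2r ?nnegrE// -natrX ler_nat ltnW// ltn_expl.
have step : (e j)%:R ^+ k * s ^+ e j <= r ^+ e j * 2^-1 ^+ j.
  apply: (@le_trans _ _ ((2 ^+ k * s) ^+ e j)).
    by rewrite exprMn ler_wpM2r// exprn_ge0.
  apply: (@le_trans _ _ ((r * 2^-1) ^+ e j)).
    rewrite lerXn2r ?nnegrE ?mulr_ge0// ?(ltW h2) ?(ltW r_gt0)//.
    rewrite -ler_pdivlMl// (le_trans sr)// exprSr invfM.
    by rewrite [leRHS]mulrC [leRHS]mulrAC -mulrA.
  rewrite exprMn ler_wpM2l ?exprn_ge0 ?(ltW r_gt0)//.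
  by rewrite ler_wiXn2l// invf_le1// ler1n.
rewrite -mulrA; apply: le_trans (ler_wpM2l (normr_ge0 _) step) _.
by rewrite mulrA ler_wpM2r ?exprn_ge0.
Qed.

Lemma lacunary_cvg s : 0 <= s -> s <= r / 2 ->
  cvgn (series (fun j => b j * s ^+ e j)).
Proof.
move=> s0 sr; apply: (proj1 (@geometric_bounded_series _ M _)) => j.
rewrite normrM (ger0_norm (exprn_ge0 _ s0)).
by have := @weighted_term_le 0 s j s0 sr; rewrite expr0 mulr1.
Qed.

(** The coefficients b j * (e j / d) are those of t d/dt applied to the series in
    t = s^d. *)
Lemma lacunary_euler_bound (d : nat) j : (0 < d)%N ->
  `|b j * ((e j)%:R / d%:R)| * (r / 2) ^+ e j <= M.
Proof.
move=> d0; apply: le_trans (bM j).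
rewrite normrM -mulrA ler_wpM2l// expr_div_n mulrCA ler_piMr ?exprn_ge0 ?(ltW r_gt0)//.
rewrite ger0_norm ?divr_ge0// -mulrA -invfM -!natrX -natrM.
rewrite ler_pdivrMr ?ltr0n ?muln_gt0 ?d0 ?expn_gt0// mul1r ler_nat.
by rewrite (leq_trans (ltnW (ltn_expl (e j) (ltnSn 1))))// leq_pmull.
Qed.

(** Termwise differentiation. The derivative is written as s^-1 times the Euler
    derivative, so that the same exponents serve for the series and for its
    derivative. *)
Lemma lacunary_is_derive s : 0 < s -> s < r / 8 ->
  is_derive s 1 (lacunary b e)
    (s^-1 * lacunary (fun j => b j * (e j)%:R) e s).
Proof.
move=> s0 sr; set F := lacunary b e; set D := s^-1 * _.
pose rho := r / 8.
have rho0 : 0 < rho by rewrite divr_gt0.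
have rho2 : rho <= r / 2 by rewrite /rho; lra.
pose K j := `|b j| * (e j)%:R ^+ 2 * rho ^+ e j * (rho ^+ 2)^-1.
have K_cvg : cvgn (series K).
  apply: (proj1 (@geometric_bounded_series _ (M * (rho ^+ 2)^-1) _)) => j.
  rewrite ger0_norm ?mulr_ge0 ?invr_ge0 ?exprn_ge0 ?(ltW rho0)//.
  rewrite mulrAC ler_wpM2r ?invr_ge0 ?exprn_ge0 ?(ltW rho0)//.
  apply: weighted_term_le; first exact: ltW.
  by rewrite (_ : 2 ^+ 3 = 8 :> R)//; ring.
have D_cvg : cvgn (series (fun j => b j * (e j)%:R * s ^+ e j)).
  apply: (proj1 (@geometric_bounded_series _ M _)) => j.
  rewrite !normrM (ger0_norm (exprn_ge0 _ (ltW s0))) normr_nat.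
  have := @weighted_term_le 1 s j (ltW s0); rewrite expr1; apply.
  by move: sr; rewrite expr2; lra.
pose k := Num.min s (rho - s).
have k0 : 0 < k by rewrite lt_min s0 subr_gt0.
pose g h j := h^-1 * (b j * (h + s) ^+ e j - b j * s ^+ e j) -
  s^-1 * (b j * (e j)%:R * s ^+ e j).
have gE h : 0 < `|h| < k -> limn (series (g h)) = h^-1 * (F (h + s) - F s) - D.
  move=> /andP[_]; rewrite lt_min !ltr_norml => /andP[/andP[h1 h2] /andP[h3 h4]].
  have hs : cvgn (series (fun j => b j * (h + s) ^+ e j)).
    by apply: lacunary_cvg; [lra|move: rho2; lra].
  have ss : cvgn (series (fun j => b j * s ^+ e j)).
    by apply: lacunary_cvg; [lra|move: rho2; rewrite /rho; lra].
  rewrite (_ : g h = h^-1 *: ((fun j => b j * (h + s) ^+ e j) -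
      (fun j => b j * s ^+ e j)) - s^-1 *: (fun j => b j * (e j)%:R * s ^+ e j)).
    rewrite lim_seriesB; [|exact/is_cvg_seriesZ/is_cvg_seriesB|exact: is_cvg_seriesZ].
    by rewrite (lim_seriesZ _ (is_cvg_seriesB hs ss)) (lim_seriesZ _ D_cvg) (lim_seriesB hs ss).
  by apply/funext.
have g0 : limn (series (g h)) @[h --> 0^'] --> 0.
  apply: (@lim_cvg_to_0_linear R K g k k0 K_cvg) => h /andP[h0].
  rewrite lt_min !ltr_norml => /andP[/andP[h1 h2] /andP[h3 h4]] j.
  have hn0 : h != 0 by rewrite -normr_gt0.
  have rem : `|(s + h) ^+ e j - s ^+ e j - h * ((e j)%:R * s ^+ (e j).-1)| *
      rho ^+ 2 <= h ^+ 2 * ((e j)%:R ^+ 2 * rho ^+ e j).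
    by apply: pow_remainder_le; rewrite ger0_norm; move: h1 h2 h3 h4; lra.
  have -> : g h j = b j * h^-1 *
      ((s + h) ^+ e j - s ^+ e j - h * ((e j)%:R * s ^+ (e j).-1)).
    rewrite /g [h + s]addrC; case: (e j) => [|i]; rewrite /= ?exprS; field;
      by rewrite hn0 gt_eqF.
  rewrite !(normrM (_ * _)) (normrM (b j)) normfV.
  have -> : K j * `|h| =
      `|b j| * `|h|^-1 * (`|h| ^+ 2 * ((e j)%:R ^+ 2 * rho ^+ e j) / rho ^+ 2).
    by rewrite /K; field; rewrite !lt0r_neq0.
  rewrite ler_wpM2l ?mulr_ge0 ?invr_ge0//.
  by rewrite real_normK ?num_real// ler_pdivlMr ?exprn_gt0.
have dF : h^-1 *: (F (h + s) - F s) @[h --> 0^'] --> D.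
  apply/cvgrPdist_lt => eps eps0.
  move/cvgrPdist_lt : g0 => /(_ _ eps0) g0.
  near=> h.
  have hk : 0 < `|h| < k.
    rewrite normr_gt0; apply/andP; split.
      by near: h; exact: nbhs_dnbhs_neq.
    near: h; apply: dnbhs0_lt => //.
  have : `|0 - limn (series (g h))| < eps by near: h.
  by rewrite gE// sub0r normrN distrC.
have dF' : (fun h => h^-1 *: ((F \o shift s) (h *: (1 : R)) - F s)) @ 0^' --> D.
  rewrite (_ : (fun h => _) = (fun h => h^-1 *: (F (h + s) - F s)))//.
  by apply/funext => h /=; rewrite [h *: 1]mulr1.
apply: DeriveDef; last exact: cvg_lim dF'.
by apply/cvg_ex; exists D.
Unshelve. all: by end_near. Qed.

End Series.
End LacunarySeries.

(** * Extrapolation of a real series *)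

Section Extrapolation.
Context {R : realType}.
Variables (m : nat) (e : nat -> nat) (w : 'I_m.+1 -> R) (s : nat -> R).
Hypothesis e_incr : forall i j, (i < j)%N -> (j <= m)%N -> (e i < e j)%N.
Hypothesis s_gt0 : 0 < s m.
Hypothesis s_decr : forall i, (i < m)%N -> s i.+1 < s i.
Hypothesis w_lt : forall j, (j < m)%N -> \sum_(i < m.+1) w i * s i ^+ e j = 0.
Hypothesis w_eq : \sum_(i < m.+1) w i * s i ^+ e m = 1.

Let s_pos i : (i <= m)%N -> 0 < s i.
Proof. by move=> /(stepwise_decr_bounds s_decr)/andP[si _]; exact: lt_le_trans si. Qed.

(** Each factor (e j - e l) / (e m - e l) of the mean value formula is at most
    e j / (e m - e l), and the mean point is at most s 0. *)
Lemma weighted_power_le j : (e m <= e j)%N ->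
  `|\sum_(i < m.+1) w i * s i ^+ e j| <=
  \prod_(l < m) ((e m)%:R - (e l)%:R)^-1 * (e j)%:R ^+ m * s 0%N ^+ (e j - e m).
Proof.
move=> ej.
have powE k (i : 'I_m.+1) : s i `^ (e k)%:R = s i ^+ e k.
  by rewrite powR_mulrn// ltW// s_pos// leq_ord.
have einj : {in [pred j | (j <= m)%N] &, injective (fun j => (e j)%:R : R)}.
  move=> i k; rewrite !inE => im km /eqP; rewrite eqr_nat => /eqP ek.
  case: (ltngtP i k) => // ik.
    by have := e_incr ik km; rewrite ek ltnn.
  by have := e_incr ik im; rewrite ek ltnn.
have [k km||xi xiE] := @divided_difference_power R m w (fun j => (e j)%:R) s (e j)%:R
    s_gt0 s_decr einj.
- by rewrite -[RHS](w_lt km); apply: eq_bigr => i _; rewrite powE.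
- by rewrite -[RHS]w_eq; apply: eq_bigr => i _; rewrite powE.
under eq_bigr => i _ do rewrite powE.
have /andP[xi1 xi2] := xiE.
have xi0 : 0 < xi := lt_le_trans s_gt0 xi1.
move=> ->; rewrite -natrB// powR_mulrn ?(ltW xi0)// normrM.
rewrite (ger0_norm (exprn_ge0 _ (ltW xi0))).
have el (l : 'I_m) : (e l < e m)%N by exact: e_incr.
apply: ler_pM => //; [exact: exprn_ge0 (ltW xi0)| |]; last first.
  by rewrite lerXn2r ?nnegrE// ltW// s_pos.
rewrite normr_prod -[m in X in _ * X]card_ord -prodr_const -big_split/=.
apply: ler_prod => l _; rewrite normr_ge0/= -!natrB ?(ltnW (el l))//; last first.
  exact: leq_trans (ltnW (el l)) ej.
by rewrite ger0_norm ?divr_ge0// mulrC ler_wpM2l ?invr_ge0// ler_nat leq_subr.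
Qed.

(** Only finitely many nodes occur, so the weights can be applied term by term;
    they annihilate the terms below m and reproduce the coefficient of index m. *)
Lemma weighted_lacunary (b : nat -> R) :
  (forall i, (i <= m)%N -> cvgn (series (fun j => b j * s i ^+ e j))) ->
  \sum_(i < m.+1) w i * lacunary b e (s i) =
  b m + limn (series (fun j =>
    if (j <= m)%N then 0 else b j * \sum_(i < m.+1) w i * s i ^+ e j)).
Proof.
move=> b_cvg; set u := (X in series X).
have c1 : \sum_(i < m.+1) w i * series (fun j => b j * s i ^+ e j) k @[k --> \oo]
    --> \sum_(i < m.+1) w i * lacunary b e (s i).
  apply: (@cvg_big R 'I_m.+1 +%R 0 xpredT (@add_continuous R) _ \oo) => i _.
  by apply: cvgMr; apply: b_cvg; exact: leq_ord.
have E k : (m < k)%N ->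
    \sum_(i < m.+1) w i * series (fun j => b j * s i ^+ e j) k = b m + series u k.
  move=> mk.
  transitivity (\sum_(0 <= j < k) b j * \sum_(i < m.+1) w i * s i ^+ e j).
    under eq_bigr => i _ do rewrite /series/= mulr_sumr.
    rewrite exchange_big/=; apply: eq_bigr => j _.
    by rewrite mulr_sumr; apply: eq_bigr => i _; rewrite mulrCA.
  have -> : b m = \sum_(0 <= j < k) (if j == m then b m else 0).
    by rewrite -big_mkcond/= big_nat1_eq leq0n mk.
  rewrite /series/= -big_split/=; apply: eq_bigr => j _; rewrite /u.
  case: (ltngtP j m) => [jm|jm|->]; last by rewrite w_eq mulr1 addr0.
    by rewrite w_lt// mulr0 addr0.
  by rewrite add0r.
have c2 : b m + series u k @[k --> \oo] --> \sum_(i < m.+1) w i * lacunary b e (s i).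
  apply: cvg_trans c1; apply: near_eq_cvg.
  by exists m.+1 => // k /= mk; rewrite E.
have c3 : series u @ \oo --> \sum_(i < m.+1) w i * lacunary b e (s i) - b m.
  rewrite (_ : series u = fun k => (b m + series u k) - b m).
    by apply: cvgB c2 _; exact: cvg_cst.
  by apply/funext => k; rewrite addrAC subrr add0r.
by rewrite (cvg_lim _ c3)// addrC subrK.
Qed.

End Extrapolation.

(** By the mean value bound the term of index j > m is at most a constant times
    |b j| (e j)^m s0^(e j - e m). Splitting off s0^(e (m+1) - e m) leaves a power
    of s0 with nonnegative exponent, which is largest at the radius
    r / 2^(m+1), where the remaining series converges geometrically. The constant
    is the same for all series with coefficient bound M. *)
Lemma extrapolation_error {R : realType} m (e : nat -> nat) (r M : R) :
  0 < r -> (forall j, (j <= e j)%N) ->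
  (forall i j, (i < j)%N -> (j <= m.+1)%N -> (e i < e j)%N) ->
  exists K, forall (b : nat -> R) (w : 'I_m.+1 -> R) (s : nat -> R),
    (forall j, `|b j| * r ^+ e j <= M) ->
    (forall j, (m < j)%N -> b j != 0 -> (e m.+1 <= e j)%N) ->
    0 < s m -> (forall i, (i < m)%N -> s i.+1 < s i) -> s 0%N <= r / 2 ^+ m.+1 ->
    (forall j, (j < m)%N -> \sum_(i < m.+1) w i * s i ^+ e j = 0) ->
    \sum_(i < m.+1) w i * s i ^+ e m = 1 ->
    `|\sum_(i < m.+1) w i * lacunary b e (s i) - b m| <=
      K * s 0%N ^+ (e m.+1 - e m).
Proof.
move=> r0 e_ge e_incr.
pose C : R := \prod_(l < m) ((e m)%:R - (e l)%:R)^-1.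
have C0 : 0 <= C.
  apply: prodr_ge0 => l _; rewrite invr_ge0 subr_ge0 ler_nat ltnW// e_incr//.
pose sg := r / 2 ^+ m.+1.
have sg0 : 0 < sg by rewrite divr_gt0// exprn_gt0.
exists (2 * (C * M / sg ^+ e m.+1)) => b w s bM b_tail sm0 s_decr s0r w_lt w_eq.
have e_incr' i j : (i < j)%N -> (j <= m)%N -> (e i < e j)%N.
  by move=> ij jm; apply: e_incr => //; exact: leq_trans jm _.
have s_le := stepwise_decr_bounds s_decr.
have s0_gt0 : 0 < s 0%N by have /andP[h _] := s_le 0%N isT; exact: lt_le_trans h.
rewrite (weighted_lacunary w_lt w_eq); last first.
  move=> i im; have /andP[h1 h2] := s_le i im.
  apply: (lacunary_cvg r0 e_ge bM); first exact/ltW/(lt_le_trans sm0).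
  rewrite (le_trans h2)// (le_trans s0r)// ler_wpM2l ?(ltW r0)//.
  rewrite lef_pV2 ?posrE ?exprn_gt0// exprS ler_peMr//.
  by rewrite exprn_ege1// ler1n.
rewrite addrC addKr -mulrA.
apply: (proj2 (@geometric_bounded_series _ _ _ _)) => j.
have M0 : 0 <= M.
  by apply: le_trans (bM 0%N); rewrite mulr_ge0// exprn_ge0// ltW.
have rhs0 : 0 <= C * M / sg ^+ e m.+1 * s 0%N ^+ (e m.+1 - e m) * 2^-1 ^+ j.
  by rewrite !mulr_ge0 ?invr_ge0 ?exprn_ge0 ?(ltW sg0) ?(ltW s0_gt0).
case: leqP => jm; first by rewrite normr0.
have [->|bj] := eqVneq (b j) 0; first by rewrite mul0r normr0.
have ej := b_tail j jm bj.
have em : (e m < e m.+1)%N by exact: e_incr.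
rewrite normrM.
apply: le_trans (ler_wpM2l (normr_ge0 _) (weighted_power_le e_incr' sm0 s_decr w_lt w_eq
  (leq_trans (ltnW em) ej))) _.
rewrite -/C.
have -> : (e j - e m = (e j - e m.+1) + (e m.+1 - e m))%N.
  by rewrite addnBA ?subnK// ltnW.
have h1 : s 0%N ^+ (e j - e m.+1) <= sg ^+ e j / sg ^+ e m.+1.
  rewrite ler_pdivlMr ?exprn_gt0//.
  apply: (@le_trans _ _ (sg ^+ (e j - e m.+1) * sg ^+ e m.+1)).
    by rewrite ler_wpM2r ?exprn_ge0 ?(ltW sg0)// lerXn2r ?nnegrE ?(ltW sg0) ?(ltW s0_gt0).
  by rewrite -exprD subnK.
have h2 := @weighted_term_le _ b e r M r0 e_ge bM m sg j (ltW sg0) (lexx _).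
apply: (@le_trans _ _ (`|b j| * (C * (e j)%:R ^+ m *
    (sg ^+ e j / sg ^+ e m.+1 * s 0%N ^+ (e m.+1 - e m))))).
  rewrite ler_wpM2l// ler_wpM2l ?mulr_ge0 ?exprn_ge0// exprD ler_wpM2r//.
  by rewrite exprn_ge0 ?(ltW s0_gt0).
have -> : `|b j| * (C * (e j)%:R ^+ m *
    (sg ^+ e j / sg ^+ e m.+1 * s 0%N ^+ (e m.+1 - e m))) =
  C / sg ^+ e m.+1 * s 0%N ^+ (e m.+1 - e m) * (`|b j| * (e j)%:R ^+ m * sg ^+ e j) by ring.
have -> : C * M / sg ^+ e m.+1 * s 0%N ^+ (e m.+1 - e m) * 2^-1 ^+ j =
  C / sg ^+ e m.+1 * s 0%N ^+ (e m.+1 - e m) * (M * 2^-1 ^+ j) by ring.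
by rewrite ler_wpM2l ?mulr_ge0 ?invr_ge0 ?exprn_ge0 ?(ltW sg0) ?(ltW s0_gt0).
Qed.

(** * Real coordinates on complex vectors *)

Section RealCoordinates.
Context {R : realType} {n : nat}.
Implicit Types (x y : 'cV[R[i]]_n) (a : bool * 'I_n).

(** Real-linear coordinates: they reduce limits, derivatives and estimates in C^n
    to real ones, without a normed R-module structure on C^n. *)
Definition rcoord x a : R :=
  if a.1 then complex.Re (x a.2 ord0) else complex.Im (x a.2 ord0).

Definition of_rcoord (g : bool * 'I_n -> R) : 'cV[R[i]]_n :=
  \col_k (g (true, k) +i* g (false, k)).

Lemma of_rcoordK g a : rcoord (of_rcoord g) a = g a.
Proof. by case: a => -[] k; rewrite /rcoord/= mxE. Qed.

Lemma rcoord_inj x y : rcoord x =1 rcoord y -> x = y.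
Proof.
move=> xy; apply/colP => k.
have := xy (true, k); have := xy (false, k); rewrite /rcoord/=.
by case: (x k ord0) => a b; case: (y k ord0) => c d /= -> ->.
Qed.

Lemma rcoordD x y a : rcoord (x + y) a = rcoord x a + rcoord y a.
Proof. by case: a => -[] k; rewrite /rcoord/= mxE raddfD. Qed.

Lemma rcoordB x y a : rcoord (x - y) a = rcoord x a - rcoord y a.
Proof. by case: a => -[] k; rewrite /rcoord/= !mxE raddfB. Qed.

Lemma rcoord0 a : rcoord 0 a = 0.
Proof. by case: a => -[] k; rewrite /rcoord/= mxE. Qed.

Lemma rcoordZ (c : R) x a : rcoord (c%:C *: x) a = c * rcoord x a.
Proof.
case: a => -[] k; rewrite /rcoord/= mxE; case: (x k ord0) => u v /=;
  by rewrite mul0r ?subr0 ?addr0.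
Qed.

Lemma rcoord_sum I (s : seq I) P (f : I -> 'cV[R[i]]_n) a :
  rcoord (\sum_(i <- s | P i) f i) a = \sum_(i <- s | P i) rcoord (f i) a.
Proof.
apply: (big_morph (fun x => rcoord x a) (fun x y => rcoordD x y a)).
exact: rcoord0.
Qed.

Lemma normc_Re_Im_le (z : R[i]) : `|z| <= (`|complex.Re z| + `|complex.Im z|)%:C.
Proof.
rewrite normc_def lecR -[leRHS]ger0_norm ?addr_ge0// -sqrtr_sqr ler_wsqrtr//.
rewrite -[complex.Re z ^+ 2]real_normK ?num_real//.
rewrite -[complex.Im z ^+ 2]real_normK ?num_real// sqrrD.
by rewrite lerD2r lerDl mulrn_wge0// mulr_ge0.
Qed.

Lemma rcoord_le_norm x a : (`|rcoord x a|)%:C <= `|x|.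
Proof.
apply: (@le_trans _ _ `|x a.2 ord0|).
  case: a => -[] k; rewrite /rcoord/=; first exact: normc_ge_Re.
  by rewrite normc_def lecR -sqrtr_sqr ler_wsqrtr// lerDr sqr_ge0.
rewrite [leRHS]/Num.norm/= mx_normE.
set B := (X in _ <= X%:num).
have /bigmax_leP[_ /(_ (a.2, ord0) isT)] : (B <= B)%O by [].
by rewrite -num_le.
Qed.

Lemma norm_le_rcoord x (K : R) : 0 <= K ->
  (forall a, `|rcoord x a| <= K) -> `|x| <= (2 * K)%:C.
Proof.
move=> K0 xK.
have K20 : (0 : R[i]) <= (2 * K)%:C by rewrite (lecR 0) mulr_ge0.
rewrite [leLHS]/Num.norm/=.
have [->//|/mx_norm_neq0[[k l] ->]/=] := eqVneq (mx_norm x) 0.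
rewrite (ord1 l); apply: le_trans (normc_Re_Im_le _) _.
rewrite lecR mulr_natl mulr2n.
exact: lerD (xK (true, k)) (xK (false, k)).
Qed.

Lemma cvg_rcoord T (F : set_system T) (FF : Filter F) (f : T -> 'cV[R[i]]_n) (l : 'cV[R[i]]_n) :
  (forall a, rcoord (f t) a @[t --> F] --> rcoord l a) -> f @ F --> l.
Proof.
move=> fl; apply/cvgrPdist_le => eps eps0.
have epsE : eps = (complex.Re eps)%:C by case: eps eps0 => u v; rewrite ltcE/= => /andP[/eqP->].
have e0 : 0 < complex.Re eps / 2.
  by move: eps0; rewrite epsE (ltcR 0)/= => ?; rewrite divr_gt0.
have : \forall t \near F, forall a, `|rcoord l a - rcoord (f t) a| <= complex.Re eps / 2.
  apply: filter_forall => a.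
  by have /cvgrPdist_le/(_ _ e0) := fl a.
apply: filterS => t tl; rewrite epsE -[complex.Re eps](mulfVK (_ : 2 != 0 :> R))// [_ * 2]mulrC.
apply: norm_le_rcoord; first exact: ltW.
by move=> a; rewrite rcoordB.
Qed.

Variables (N : 'cV[R[i]]_n -> R) (N_norm : is_norm N).

Lemma is_norm_scale (c : R) x : N (c%:C *: x) = `|c| * N x.
Proof. by case: N_norm => _ -> _; rewrite normc_def/= expr0n/= addr0 sqrtr_sqr. Qed.

Lemma is_norm0 : N 0 = 0.
Proof. by rewrite -(scale0r 0) is_norm_scale normr0 mul0r. Qed.

Lemma is_normN x : N (- x) = N x.
Proof.
have -> : - x = (-1)%:C *: x by rewrite rmorphN1 scaleN1r.
by rewrite is_norm_scale normrN1 mul1r.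
Qed.

Lemma is_norm_ge0 x : 0 <= N x.
Proof.
case: (N_norm) => ND _ _; have := ND x (- x); rewrite subrr is_norm0 is_normN; lra.
Qed.

Lemma is_norm_gt0 x : x != 0 -> 0 < N x.
Proof.
move=> x0; rewrite lt_def is_norm_ge0 andbT; apply: contra x0 => /eqP Nx.
by case: (N_norm) => _ _ /(_ x Nx) ->.
Qed.

(** An arbitrary norm on C^n is controlled by the coordinates, by expanding a
    vector in the standard basis. *)
Lemma is_norm_rcoord : exists2 C : R, 0 <= C &
  forall x K, (forall a, `|rcoord x a| <= K) -> N x <= C * K.
Proof.
exists (\sum_(k < n) 2 * N (delta_mx k ord0)).
  by apply: sumr_ge0 => k _; rewrite mulr_ge0// is_norm_ge0.
move=> x K xK; case: (N_norm) => ND NZ _.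
rewrite [in leLHS](matrix_sum_delta x).
have Nsum (f : 'I_n -> 'cV[R[i]]_n) : N (\sum_k f k) <= \sum_k N (f k).
  elim/big_ind2 : _ => //; first by rewrite is_norm0.
  by move=> u1 u2 v1 v2 h1 h2; apply: le_trans (ND _ _) _; exact: lerD.
apply: le_trans (Nsum _) _; rewrite mulr_suml; apply: ler_sum => k _.
rewrite big_ord1 NZ mulrAC ler_wpM2r ?is_norm_ge0//.
have := normc_Re_Im_le (x k ord0); rewrite lecE/= => /andP[_ h].
apply: le_trans h _; rewrite mulr_natl mulr2n.
exact: lerD (xK (true, k)) (xK (false, k)).
Qed.

End RealCoordinates.

(** * Coordinates of a Puiseux series and of its derivative *)

Lemma powR_root_lt {R : realType} (d : nat) (x y : R) :
  (0 < d)%N -> 0 <= x -> 0 <= y -> x < y ^+ d -> x `^ d%:R^-1 < y.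
Proof.
move=> d0 x0 y0 xy.
have dn0 : d%:R != 0 :> R by rewrite pnatr_eq0 -lt0n.
have -> : y = (y ^+ d) `^ d%:R^-1 by rewrite -powR_mulrn// -powRrM mulfV// powRr1.
by apply: gt0_ltr_powR; rewrite ?invr_gt0 ?ltr0n// nnegrE ?exprn_ge0.
Qed.

Section PuiseuxSeries.
Context {R : realType} {n : nat}.
Variables (z : puiseux R n) (d : nat) (e0 : nat -> nat).
Hypothesis d_gt0 : (0 < d)%N.
Hypothesis e0E : forall j, is_term (last_term z) j -> (e0 j)%:R = d%:R * expo z j.

(** Total coefficient and exponent sequences: z^* becomes the term of index 0,
    and after the last term the coefficients vanish while the exponents still
    satisfy j <= pexpo j, which makes geometric majorants available. *)
Definition pcoef (j : nat) : 'cV[R[i]]_n :=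
  if j == 0%N then zstar z else if is_term (last_term z) j then coef z j else 0.

Definition pexpo (j : nat) : nat := if is_term (last_term z) j then e0 j else j.

Lemma is_term_le i j : (i <= j)%N -> is_term (last_term z) j -> is_term (last_term z) i.
Proof. by rewrite /is_term; case: last_term => // l; exact: leq_trans. Qed.

Lemma expo_mono i j : (i < j)%N -> is_term (last_term z) j -> expo z i < expo z j.
Proof.
elim: j => // j IH; rewrite ltnS leq_eqVlt => /predU1P[->|ij] tj.
  exact: expo_lt.
by apply: lt_trans (IH ij (is_term_le (leqnSn j) tj)) _; exact: expo_lt.
Qed.

Lemma pexpo_mono i j : (i < j)%N -> is_term (last_term z) j -> (pexpo i < pexpo j)%N.
Proof.
move=> ij tj; have ti := is_term_le (ltnW ij) tj.
rewrite /pexpo ti tj -(ltr_nat rat) !e0E// ltr_pM2l ?ltr0n//.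
exact: expo_mono.
Qed.

Lemma pexpo_ge j : (j <= pexpo j)%N.
Proof.
elim: j => // j IH; have [tj|tj] := boolP (is_term (last_term z) j.+1).
  by apply: leq_ltn_trans IH _; exact: pexpo_mono.
by rewrite /pexpo (negbTE tj).
Qed.

Lemma pcoef_not_term j : (0 < j)%N -> ~~ is_term (last_term z) j -> pcoef j = 0.
Proof. by rewrite /pcoef => j0 /negbTE->; rewrite gtn_eqF. Qed.

Lemma pcoef_term j : (0 < j)%N -> is_term (last_term z) j -> pcoef j = coef z j.
Proof. by rewrite /pcoef => j0 ->; rewrite gtn_eqF. Qed.

Lemma pexpo0 : pexpo 0 = 0%N.
Proof.
rewrite /pexpo; case: ifP => // tz; apply/eqP.
by rewrite -(eqr_nat rat) e0E// expo0 mulr0.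
Qed.

Lemma expo_ratio j : is_term (last_term z) j ->
  ratr (expo z j) = (pexpo j)%:R / d%:R :> R.
Proof.
move=> tj; have dn0 : d%:R != 0 :> rat by rewrite pnatr_eq0 -lt0n.
have -> : expo z j = (e0 j)%:R / d%:R by rewrite e0E// mulrC mulKf.
by rewrite /pexpo tj fmorph_div !rmorph_nat.
Qed.

Lemma powR_expo (t : R) j : is_term (last_term z) j ->
  t `^ ratr (expo z j) = (t `^ d%:R^-1) ^+ pexpo j.
Proof. by move=> tj; rewrite expo_ratio// mulrC powRrM powR_mulrn// powR_ge0. Qed.

(** The partial sums converge at some r > 0, so their differences, which are the
    terms of the series, are bounded. *)
Lemma pcoef_bounded :
  (\forall s \near (0 : R[i]), cvgn (fun k : nat => zstar z +
     \sum_(1 <= j < k | is_term (last_term z) j) s ^+ e0 j *: coef z j)) ->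
  exists2 r : R, 0 < r &
    exists M, forall a j, `|rcoord (pcoef j) a| * r ^+ pexpo j <= M.
Proof.
move=> /nbhs_ballP[eps /= eps0 zcvg].
have epsE : eps = (complex.Re eps)%:C.
  by case: (eps) eps0 => u v; rewrite ltcE/= => /andP[/eqP->].
pose r := complex.Re eps / 2.
have r0 : 0 < r by move: eps0; rewrite epsE (ltcR 0)/= => ?; rewrite divr_gt0.
exists r => //; set u := fun k : nat => zstar z +
  \sum_(1 <= j < k | is_term (last_term z) j) r%:C ^+ e0 j *: coef z j.
have /cvg_seq_bounded/ex_strict_bound_gt0[K /ltW K0 uK] : cvgn u.
  apply: zcvg; rewrite /ball/= sub0r normrN epsE normc_def/= expr0n/= addr0.
  by rewrite sqrtr_sqr ltcR ger0_norm ?(ltW r0)//; move: r0; rewrite /r; lra.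
have {}K0 : 0 <= complex.Re K by move: K0; rewrite lecE => /andP[].
exists (2 * complex.Re K) => a j.
have uRe k : `|rcoord (u k) a| <= complex.Re K.
  by have := le_trans (rcoord_le_norm _ a) (ltW (uK k I)); rewrite lecE/= => /andP[].
case: j => [|j].
  rewrite pexpo0 expr0 mulr1 /pcoef/=; have := uRe 0%N.
  by rewrite /u big_geq// addr0; lra.
have [tj|tj] := boolP (is_term (last_term z) j.+1); last first.
  by rewrite pcoef_not_term// rcoord0 normr0 mul0r mulr_ge0.
rewrite pcoef_term// -[X in _ * X]ger0_norm ?exprn_ge0 ?(ltW r0)// -normrM mulrC.
rewrite -rcoordZ /pexpo tj rmorphXn.
have -> : r%:C ^+ e0 j.+1 *: coef z j.+1 = u j.+2 - u j.+1.
  rewrite /u [in X in X - _]big_mkcond big_nat_recr//= tj -big_mkcond/=.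
  by rewrite addrA [RHS]addrAC subrr add0r.
rewrite rcoordB mulr_natl mulr2n; apply: le_trans (ler_normB _ _) _.
exact: lerD.
Qed.

(** A terminating series has no restriction on the radius. *)
Lemma pcoef_bounded_finite l (r : R) : last_term z = Some l -> 0 < r ->
  exists M, forall a j, `|rcoord (pcoef j) a| * r ^+ pexpo j <= M.
Proof.
move=> lE r0.
exists (\sum_(j < l.+1) \sum_(a : bool * 'I_n) `|rcoord (pcoef j) a| * r ^+ pexpo j).
move=> a j; have [jl|lj] := leqP j l.
  rewrite (bigD1 (Ordinal (jl : (j < l.+1)%N)))//= (bigD1 a)//= -addrA.
  rewrite lerDl addr_ge0 ?sumr_ge0// => *; rewrite ?sumr_ge0// => *;
    by rewrite mulr_ge0 ?exprn_ge0 ?(ltW r0).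
rewrite pcoef_not_term ?(leq_ltn_trans _ lj)//; last by rewrite lE/= -ltnNge.
rewrite rcoord0 normr0 mul0r; do 2!apply: sumr_ge0 => ? _.
by rewrite mulr_ge0 ?exprn_ge0 ?(ltW r0).
Qed.

Section Eval.
Variables (r M : R).
Hypothesis r_gt0 : 0 < r.
Hypothesis pcoefM : forall a j, `|rcoord (pcoef j) a| * r ^+ pexpo j <= M.

Lemma rcoord_puiseux_eval t a : 0 < t -> t < (r / 8) ^+ d ->
  rcoord (puiseux_eval z t) a =
  lacunary (fun j => rcoord (pcoef j) a) pexpo (t `^ d%:R^-1).
Proof.
move=> t0 tr; set s := t `^ _.
have s0 : 0 < s by exact: powR_gt0.
have sr : s < r / 8 by apply: powR_root_lt; rewrite ?divr_ge0 ?ltW.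
rewrite -[RHS](of_rcoordK (fun a => lacunary (fun j => rcoord (pcoef j) a) pexpo s)).
congr (rcoord _ a); apply: cvg_lim; first exact: norm_hausdorff.
apply: cvg_rcoord => c; rewrite of_rcoordK.
have : series (fun j => rcoord (pcoef j) c * s ^+ pexpo j) @ \oo -->
    lacunary (fun j => rcoord (pcoef j) c) pexpo s.
  by apply: (lacunary_cvg r_gt0 pexpo_ge (pcoefM c)); [exact: ltW|move: sr; lra].
apply: cvg_trans; apply: near_eq_cvg; exists 1%N => // k /= k1.
rewrite /series/= big_ltn// rcoordD [in LHS]/pcoef eqxx.
rewrite pexpo0 expr0 mulr1; congr (_ + _); rewrite rcoord_sum [RHS]big_mkcond/=.
apply: eq_big_nat => j /andP[j1 _]; rewrite /pcoef gtn_eqF//.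
case: ifP => [tj|]; first by rewrite rcoordZ powR_expo// mulrC.
by rewrite rcoord0 mul0r.
Qed.

(** Chain rule for s = t^(1/d): t ds/dt = s / d, so t d/dt multiplies the term of
    index j by its exponent pexpo j / d. *)
Lemma rcoord_derivC t a : 0 < t -> t < (r / 8) ^+ d ->
  t * rcoord (derivC (puiseux_eval z) t) a =
  lacunary (fun j => rcoord (pcoef j) a * ((pexpo j)%:R / d%:R)) pexpo (t `^ d%:R^-1).
Proof.
move=> t0 tr; set s := t `^ _.
have s0 : 0 < s by exact: powR_gt0.
have sr : s < r / 8 by apply: powR_root_lt; rewrite ?divr_ge0 ?ltW.
pose b c j := rcoord (pcoef j) c.
pose D c : R := (s^-1 * lacunary (fun j => b c j * (pexpo j)%:R) pexpo s) *
  (d%:R^-1 * t `^ (d%:R^-1 - 1)).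
have dD c : is_derive t 1 (lacunary (b c) pexpo \o (fun x : R => x `^ d%:R^-1)) (D c).
  apply: is_derive1_comp.
    have dl := lacunary_is_derive r_gt0 pexpo_ge (pcoefM c) s0 sr; exact: dl.
  exact: is_derive1_powR.
have -> : derivC (puiseux_eval z) t = of_rcoord D.
  apply: cvg_lim; first exact: norm_hausdorff.
  apply: cvg_rcoord => c; rewrite of_rcoordK.
  have [+ <-] := dD c.
  apply: cvg_trans; apply: near_eq_cvg; near=> h.
  have [h0 hr] : 0 < t + h /\ t + h < (r / 8) ^+ d.
    have : `|h| < Num.min t ((r / 8) ^+ d - t).
      by near: h; apply: dnbhs0_lt; rewrite lt_min t0 subr_gt0.
    by rewrite lt_min !ltr_norml => /andP[/andP[? ?] /andP[? ?]]; split; lra.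
  have quotE : rcoord ((h^-1)%:C *: (puiseux_eval z (t + h) - puiseux_eval z t)) c =
      h^-1 * (lacunary (b c) pexpo ((t + h) `^ d%:R^-1) - lacunary (b c) pexpo s).
    rewrite rcoordZ rcoordB; congr (_ * (_ - _)).
      exact: (rcoord_puiseux_eval c h0 hr).
    exact: (rcoord_puiseux_eval c t0 tr).
  by rewrite [RHS]quotE /= [h *: 1]mulr1 [h + t]addrC.
rewrite of_rcoordK /D.
have E_cvg : cvgn (series (fun j => b a j * (pexpo j)%:R * s ^+ pexpo j)).
  apply: (proj1 (@geometric_bounded_series _ _ M _)) => j.
  rewrite !normrM (ger0_norm (exprn_ge0 _ (ltW s0))) normr_nat.
  have := @weighted_term_le _ _ _ r M r_gt0 pexpo_ge (pcoefM a) 1 s j (ltW s0).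
  by rewrite expr1; apply; move: sr; rewrite expr2; lra.
have -> : lacunary (fun j => b a j * ((pexpo j)%:R / d%:R)) pexpo s =
    d%:R^-1 * lacunary (fun j => b a j * (pexpo j)%:R) pexpo s.
  rewrite -[RHS](lim_seriesZ d%:R^-1 E_cvg) /lacunary; congr (limn (series _)).
  by apply/funext => j; rewrite [RHS]mulrC /b; ring.
have -> : t * (s^-1 * lacunary (fun j => b a j * (pexpo j)%:R) pexpo s *
    (d%:R^-1 * t `^ (d%:R^-1 - 1))) =
  (t `^ (d%:R^-1 - 1) * t) / s * (d%:R^-1 * lacunary (fun j => b a j * (pexpo j)%:R) pexpo s).
  by ring.
rewrite -[X in _ * X / s](powRr1 (ltW t0)) -powRD_gt0// subrK -/s divff ?mul1r//.
exact: lt0r_neq0.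
Unshelve. all: by end_near. Qed.

End Eval.
End PuiseuxSeries.

(** * Extrapolation of a Puiseux series *)

Section PuiseuxExtrapolation.
Context {R : realType} {n : nat}.
Variables (z : puiseux R n) (d : nat) (e0 : nat -> nat).
Hypothesis d_gt0 : (0 < d)%N.
Hypothesis e0E : forall j, is_term (last_term z) j -> (e0 j)%:R = d%:R * expo z j.

Local Notation pe := (pexpo z e0).

(** The nodes in the variable s = t^(1/d), in which the series has natural
    exponents. *)
Definition root_sample m (t : 'I_m.+1 -> R) (i : nat) : R :=
  t (inord i) `^ d%:R^-1.

Section SamplePoints.
Variables (m : nat) (t : 'I_m.+1 -> R) (w : 'cV[R]_m.+1).
Hypothesis m_gt0 : (0 < m)%N.
Hypothesis m_term : is_term (last_term z) m.
Hypothesis t_gt0 : 0 < t ord_max.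
Hypothesis t_decr : forall i j : 'I_m.+1, (i < j)%N -> t j < t i.
Hypothesis w_weight : is_weight z t w.

Local Notation s := (root_sample t).

Let t_pos i : 0 < t i.
Proof.
apply: (lt_le_trans t_gt0); have [im|] := ltnP i m; first exact/ltW/t_decr.
by move=> mi; rewrite (_ : i = ord_max)//; apply/val_inj/eqP; rewrite eqn_leq mi leq_ord.
Qed.

Lemma sample_le_max i : t i <= t ord0.
Proof.
have [i0|] := ltnP 0%N i; first exact/ltW/t_decr.
by rewrite leqn0 => i0; rewrite (_ : i = ord0)//; apply/val_inj/eqP.
Qed.

Lemma root_sample_gt0 : 0 < s m. Proof. exact: powR_gt0. Qed.

Lemma root_sample_decr i : (i < m)%N -> s i.+1 < s i.
Proof.
move=> im; apply: gt0_ltr_powR; rewrite ?invr_gt0 ?ltr0n// ?nnegrE ?ltW//.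
by apply: t_decr; rewrite !inordK// ltnW.
Qed.

Lemma weight_root_lt j : (j < m)%N -> \sum_(i < m.+1) w i ord0 * s i ^+ pe j = 0.
Proof.
move=> jm; have [/(_ j jm) w0 _] := w_weight; rewrite -[RHS]w0.
apply: eq_bigr => i _; rewrite /root_sample inord_val -(powR_expo d_gt0 e0E)//.
exact: is_term_le (ltnW jm) m_term.
Qed.

Lemma weight_root_eq : \sum_(i < m.+1) w i ord0 * s i ^+ pe m = 1.
Proof.
have [_ w1] := w_weight; rewrite -[RHS]w1.
by apply: eq_bigr => i _; rewrite /root_sample inord_val -(powR_expo d_gt0 e0E).
Qed.

Section Radius.
Variables (r M : R).
Hypothesis r_gt0 : 0 < r.
Hypothesis pcoefM : forall a j, `|rcoord (pcoef z j) a| * r ^+ pe j <= M.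
Hypothesis t_lt : t ord0 < (r / 8) ^+ d.

Let t_small i : t i < (r / 8) ^+ d.
Proof. exact: le_lt_trans (sample_le_max i) t_lt. Qed.

Lemma rcoord_Am a : rcoord (Am z t w) a =
  \sum_(i < m.+1) w i ord0 * lacunary (fun j => rcoord (pcoef z j) a) pe (s i).
Proof.
rewrite /Am rcoord_sum; apply: eq_bigr => i _; rewrite rcoordZ /root_sample inord_val.
by rewrite (rcoord_puiseux_eval d_gt0 e0E r_gt0 pcoefM).
Qed.

Lemma rcoord_Bm a : rcoord (Bm z t w) a =
  \sum_(i < m.+1) w i ord0 *
    lacunary (fun j => rcoord (pcoef z j) a * ((pe j)%:R / d%:R)) pe (s i).
Proof.
rewrite /Bm rcoord_sum; apply: eq_bigr => i _; rewrite rcoordZ -mulrA /root_sample inord_val.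
by rewrite (rcoord_derivC d_gt0 e0E r_gt0 pcoefM).
Qed.

(** No term of index above m remains, so both weighted sums reduce to the term of
    index m. *)
Lemma exact_extrapolation : last_term z = Some m ->
  Am z t w = coef z m /\ Bm z t w = (ratr (expo z m))%:C *: coef z m.
Proof.
move=> lE.
have lac (c : nat -> R) r' : 0 < r' -> (forall j, `|c j| * r' ^+ pe j <= M) ->
    (forall i : 'I_m.+1, s i <= r' / 2) -> (forall j, (m < j)%N -> c j = 0) ->
    \sum_(i < m.+1) w i ord0 * lacunary c pe (s i) = c m.
  move=> r'0 cM sr c0; rewrite (weighted_lacunary weight_root_lt weight_root_eq); last first.
    move=> i im; apply: (lacunary_cvg r'0 (pexpo_ge d_gt0 e0E) cM); first exact: powR_ge0.
    exact: (sr (Ordinal (im : (i < m.+1)%N))).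
  rewrite (_ : series _ = cst 0) ?lim_cst ?addr0//.
  apply/funext => k; rewrite /series/= big1// => j _.
  by case: leqP => // mj; rewrite c0// mul0r.
have sr (i : 'I_m.+1) : s i < r / 8.
  by apply: powR_root_lt => //; [exact: ltW|rewrite divr_ge0// ltW].
have c0 a j : (m < j)%N -> rcoord (pcoef z j) a = 0.
  move=> mj; rewrite pcoef_not_term ?rcoord0 ?(leq_ltn_trans _ mj)//.
  by rewrite lE/= -ltnNge.
split; apply: rcoord_inj => a.
  rewrite rcoord_Am (lac _ r)//; first by rewrite pcoef_term.
  - by move=> i; have := sr i; move: r_gt0; lra.
  - exact: c0.
rewrite rcoord_Bm (lac _ (r / 2))//.
- by rewrite pcoef_term// rcoordZ (expo_ratio d_gt0 e0E)// mulrC.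
- by rewrite divr_gt0.
- by move=> j; exact: (lacunary_euler_bound r_gt0 (pcoefM a)).
- by move=> i; have := sr i; move: r_gt0; lra.
- by move=> j mj; rewrite c0// mul0r.
Qed.

End Radius.

End SamplePoints.

(** Both series are handled at the radius r / 2, where the factors pexpo j / d of
    the Euler derivative are absorbed by the bound M; hence one constant K. *)
Lemma extrapolation_errors m (r M : R) : (0 < m)%N ->
  is_term (last_term z) m.+1 -> 0 < r ->
  (forall a j, `|rcoord (pcoef z j) a| * r ^+ pe j <= M) ->
  exists K, forall (t : 'I_m.+1 -> R) (w : 'cV[R]_m.+1),
    0 < t ord_max -> (forall i j : 'I_m.+1, (i < j)%N -> t j < t i) ->
    is_weight z t w -> t ord0 < (r / 2 ^+ m.+3) ^+ d ->
    let tau := t ord0 `^ ratr (expo z m.+1 - expo z m) in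
    forall a, `|rcoord (Am z t w - coef z m) a| <= K * tau /\
      `|rcoord (Bm z t w - (ratr (expo z m))%:C *: coef z m) a| <= K * tau.
Proof.
move=> m_gt0 m1_term r0 pM.
have m_term := is_term_le (leqnSn m) m1_term.
have r20 : 0 < r / 2 by rewrite divr_gt0.
have e_incr i j : (i < j)%N -> (j <= m.+1)%N -> (pe i < pe j)%N.
  by move=> ij jm; apply: (pexpo_mono d_gt0 e0E ij); exact: is_term_le m1_term.
have [K KP] := @extrapolation_error R m pe (r / 2) M r20 (pexpo_ge d_gt0 e0E) e_incr.
exists K => t w t_gt0 t_decr w_weight tr tau a.
have s_gt0 := @root_sample_gt0 m t t_gt0 t_decr.
have s_decr := @root_sample_decr m t t_gt0 t_decr.
have w_lt := @weight_root_lt m t w m_term w_weight.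
have w_eq := @weight_root_eq m t w m_term w_weight.
have tail j : (m < j)%N -> rcoord (pcoef z j) a != 0 -> (pe m.+1 <= pe j)%N.
  move=> mj; have [tj _|tj] := boolP (is_term (last_term z) j); last first.
    by rewrite pcoef_not_term ?(leq_ltn_trans _ mj)// rcoord0 eqxx.
  move: mj; rewrite leq_eqVlt => /predU1P[<-//|mj].
  exact/ltnW/(pexpo_mono d_gt0 e0E).
have s0E : root_sample t 0 = t ord0 `^ d%:R^-1.
  by rewrite /root_sample; congr (t _ `^ _); apply/val_inj; rewrite /= inordK.
have t0_ge0 : 0 <= t ord0.
  exact: le_trans (ltW t_gt0) (sample_le_max t_decr _).
have s0r : root_sample t 0 <= r / 2 / 2 ^+ m.+1.
  rewrite s0E; apply/ltW/(@lt_trans _ _ (r / 2 ^+ m.+3)).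
    by apply: powR_root_lt => //; rewrite divr_ge0 ?exprn_ge0// ltW.
  rewrite -mulrA ltr_pM2l// -invfM -exprS.
  by rewrite ltf_pV2 ?posrE ?exprn_gt0// ltr_eXn2l ?ltr1n.
have t8 : t ord0 < (r / 8) ^+ d.
  apply: (lt_le_trans tr); rewrite lerXn2r ?nnegrE ?divr_ge0 ?exprn_ge0 ?(ltW r0)//.
  rewrite ler_pM2l// lef_pV2 ?posrE ?exprn_gt0//.
  rewrite (_ : 8 = 2 ^+ 3); last by ring.
  by rewrite ler_eXn2l ?ltr1n.
have tauE : tau = root_sample t 0 ^+ (pe m.+1 - pe m).
  have em : (pe m <= pe m.+1)%N by exact/ltnW/e_incr.
  rewrite /tau rmorphB/= !(expo_ratio d_gt0 e0E)// -mulrBl -natrB// mulrC.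
  by rewrite powRrM powR_mulrn ?powR_ge0// s0E.
rewrite tauE; split; rewrite rcoordB.
  rewrite (rcoord_Am w t_gt0 t_decr r0 pM t8) -pcoef_term//.
  apply: KP => // j.
  apply: le_trans (pM a j); rewrite ler_wpM2l// lerXn2r ?nnegrE ?(ltW r0) ?(ltW r20)//.
  by move: r0; lra.
rewrite (rcoord_Bm w t_gt0 t_decr r0 pM t8).
have -> : rcoord ((ratr (expo z m))%:C *: coef z m) a =
    rcoord (pcoef z m) a * ((pe m)%:R / d%:R).
  by rewrite rcoordZ pcoef_term// (expo_ratio d_gt0 e0E)// mulrC.
apply: (KP (fun j => rcoord (pcoef z j) a * ((pe j)%:R / d%:R))) => // [j|j mj].
  exact: (lacunary_euler_bound r0 (pM a)).
by rewrite mulf_eq0 negb_or => /andP[/(tail j mj)].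
Qed.

End PuiseuxExtrapolation.

Theorem theorem16 (R : realType) (n : nat) (N : 'cV[R[i]]_n -> R)
  (N_norm : is_norm N)
  (z : puiseux R n) (m : nat) (m_ge1 : (1 <= m)%N)
  (m_term : is_term (last_term z) m)
  (delta : R) (delta_gt0 : 0 < delta)
  (t : R -> 'I_m.+1 -> R) (w : R -> 'cV[R]_m.+1)
  (t_0 : forall t0 : R, t t0 ord0 = t0)
  (t_gt0 : forall t0 : R, 0 < t0 < delta -> 0 < t t0 ord_max)
  (t_decr : forall t0 : R, 0 < t0 < delta ->
     forall i j : 'I_m.+1, (i < j)%N -> t t0 j < t t0 i)
  (w_weight : forall t0 : R, 0 < t0 < delta -> is_weight z (t t0) (w t0)) :
  (is_term (last_term z) m.+1 ->
     (fun t0 : R => phat z (t t0) (w t0) N - ratr (expo z m))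
       =O_ (0^'+) (fun t0 : R => t0 `^ ratr (expo z m.+1 - expo z m)) /\
     (fun t0 : R => coef z m - Am z (t t0) (w t0))
       =O_ (0^'+) (fun t0 : R => (t0 `^ ratr (expo z m.+1 - expo z m))%:C)) /\
  (last_term z = Some m ->
     forall t0 : R, 0 < t0 < delta ->
       phat z (t t0) (w t0) N = ratr (expo z m) /\
       Am z (t t0) (w t0) = coef z m).
Proof.
have [d [e0 [d0 e0E conv]]] := puiseux_conv z.
set p := ratr (expo z m) : R.
set a := coef z m.
have a_gt0 : 0 < N a by apply: (is_norm_gt0 N_norm); exact: coef_neq0.
have p_ge0 : 0 <= p.
  by rewrite /p ler0q -(expo0 z) ltW//; exact: expo_mono.
split=> [m1_term|lE t0 /[dup] t0_gt /andP[t0_gt0 _]]; last first.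
  (* Any radius will do; this one makes (r / 8)^d exceed t0. *)
  pose r : R := 8 * (t0 `^ d%:R^-1 + 1).
  have r0 : 0 < r by rewrite mulr_gt0// ltr_wpDl// powR_ge0.
  have [M pM] := @pcoef_bounded_finite R n z e0 m r lE r0.
  have t_lt : t t0 ord0 < (r / 8) ^+ d.
    rewrite t_0 /r [8 * _]mulrC mulfK//.
    have {1}-> : t0 = (t0 `^ d%:R^-1) ^+ d.
      by rewrite -powR_mulrn ?powR_ge0// -powRrM mulVf ?powRr1 ?(ltW t0_gt0)// pnatr_eq0 -lt0n.
    by rewrite ltrXn2r ?nnegrE ?addr_ge0 ?powR_ge0// -?lt0n// ltrDl.
  have [AE BE] := exact_extrapolation d0 e0E m_ge1 m_term (t_gt0 _ t0_gt) (t_decr _ t0_gt)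
    (w_weight _ t0_gt) r0 pM t_lt lE.
  split=> //; rewrite /phat AE BE (is_norm_scale N_norm) ger0_norm// mulfK//.
  exact: lt0r_neq0.
have [r r0 [M pM]] := pcoef_bounded e0E conv.
set tau := fun t0 : R => t0 `^ ratr (expo z m.+1 - expo z m).
have [K KP] := extrapolation_errors d0 e0E m_ge1 m1_term r0 pM.
have [C C0 NC] := is_norm_rcoord N_norm.
have p_lt : 0 < ratr (expo z m.+1 - expo z m) :> R.
  by rewrite ltr0q subr_gt0; exact: expo_lt.
have T0 : 0 < (r / 2 ^+ m.+3) ^+ d by rewrite exprn_gt0// divr_gt0// exprn_gt0.
have errs : \forall t0 \near 0^'+, forall c,
    `|rcoord (Am z (t t0) (w t0) - a) c| <= K * tau t0 /\
    `|rcoord (Bm z (t t0) (w t0) - p%:C *: a) c| <= K * tau t0.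
  near=> t0 => c.
  have t0_gt : 0 < t0 < delta.
    by apply/andP; split; near: t0; [exact: nbhs_right_gt|exact: nbhs_right_lt].
  have := KP (t t0) (w t0) (t_gt0 _ t0_gt) (t_decr _ t0_gt) (w_weight _ t0_gt).
  rewrite t_0; apply; near: t0; exact: nbhs_right_lt.
pose K' := 1 + `|K|.
have K'0 : 0 < K' by rewrite ltr_pwDl.
have tau0 t0 : 0 <= tau t0 by exact: powR_ge0.
have KK' t0 : K * tau t0 <= K' * tau t0.
  by rewrite ler_wpM2r// /K' (le_trans (ler_norm K))// lerDr.
split; last first.
  apply/eqO_exP; exists (2 * K')%:C; first by rewrite (ltcR 0) mulr_gt0.
  apply: filterS errs => t0 tP.
  have -> : `|(tau t0)%:C| = (tau t0)%:C by rewrite ger0_norm// (lecR 0).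
  rewrite -rmorphM/= -mulrA distrC; apply: norm_le_rcoord; first exact: mulr_ge0 (ltW K'0) _.
  by move=> c; have [h _] := tP c; exact: le_trans (KK' t0).
(* The errors become smaller than N a / 2, which keeps the denominator N (A_m)
   above N a / 2. *)
have small : \forall t0 \near 0^'+, C * (K' * tau t0) <= N a / 2.
  have /cvgrPdist_le := powR_cvg0 p_lt.
  have e0' : 0 < N a / 2 / (C * K' + 1).
    by rewrite !divr_gt0// ltr_wpDl// mulr_ge0// ltW.
  move=> /(_ _ e0'); apply: filterS => t0; rewrite sub0r normrN ger0_norm ?tau0//.
  rewrite ler_pdivlMr ?ltr_wpDl ?mulr_ge0 ?(ltW K'0)//; apply: le_trans.
  by rewrite mulrA mulrC -/(tau t0) ler_wpM2l// lerDl.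
apply/eqO_exP; exists (C * K' * (1 + p) * 2 / N a + 1).
  rewrite ltr_wpDl// divr_ge0 ?(ltW a_gt0)// !mulr_ge0 ?(ltW K'0) ?addr_ge0//.
near=> t0.
have tP : forall c,
    `|rcoord (Am z (t t0) (w t0) - a) c| <= K * tau t0 /\
    `|rcoord (Bm z (t t0) (w t0) - p%:C *: a) c| <= K * tau t0 by near: t0.
have tS : C * (K' * tau t0) <= N a / 2 by near: t0.
set A := Am z _ _ in tP *; set B := Bm z _ _ in tP *.
have NA : N (A - a) <= C * (K' * tau t0).
  by apply: NC => c; have [h _] := tP c; exact: le_trans h (KK' t0).
have NB : N (B - p%:C *: a) <= C * (K' * tau t0).
  by apply: NC => c; have [_ h] := tP c; exact: le_trans h (KK' t0).
have [ND _ _] := N_norm.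
have NDB x y : N x - N y <= N (x - y).
  by have := ND (x - y) y; rewrite subrK; lra.
have A2 : N a / 2 <= N A.
  have := NDB a A; rewrite -[N (a - A)](is_normN N_norm) opprB; lra.
have A_gt0 : 0 < N A by apply: lt_le_trans A2; rewrite divr_gt0.
have BpA : `|N B - p * N A| <= C * (K' * tau t0) * (1 + p).
  have pA : p * N A = N (p%:C *: A) by rewrite (is_norm_scale N_norm) ger0_norm.
  have le : N (B - p%:C *: A) <= C * (K' * tau t0) * (1 + p).
    have -> : B - p%:C *: A = (B - p%:C *: a) - p%:C *: (A - a).
      by rewrite scalerBr opprB addrA subrK.
    apply: le_trans (ND _ _) _; rewrite (is_normN N_norm) (is_norm_scale N_norm) ger0_norm//.
    by rewrite mulrDr mulr1 lerD// [leRHS]mulrC ler_wpM2l.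
  rewrite pA ler_norml; apply/andP; split; last exact: le_trans (NDB _ _) le.
  have := NDB (p%:C *: A) B; rewrite -[N (_ - B)](is_normN N_norm) opprB; lra.
rewrite /phat -/A -/B [X in _ <= _ * X]ger0_norm ?tau0//.
have -> : N B / N A - p = (N B - p * N A) / N A by field; exact: lt0r_neq0.
rewrite normrM normfV (gtr0_norm A_gt0) ler_pdivrMr//; apply: (le_trans BpA).
apply: (@le_trans _ _ ((C * K' * (1 + p) * 2 / N a + 1) * tau t0 * (N a / 2))); last first.
  rewrite ler_wpM2l// mulr_ge0// addr_ge0// divr_ge0 ?(ltW a_gt0)//.
  by rewrite !mulr_ge0 ?(ltW K'0) ?addr_ge0.
have -> : (C * K' * (1 + p) * 2 / N a + 1) * tau t0 * (N a / 2) =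
    C * (K' * tau t0) * (1 + p) + tau t0 * (N a / 2) by field; exact: lt0r_neq0.
by rewrite lerDl mulr_ge0// divr_ge0// ltW.
Unshelve. all: by end_near. Qed.
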